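(* Let $n$, $m$, $h$ be positive integers and $d$ a positive divisor of $n$. Let $c, k_1, k_2$ be positive integers with $m = k_1 + (c-1)d + k_2$, $k_1 < d$, $k_2 < d$, $k_1 + k_2 > d$; let $H=\{j\cdot\tfrac{n}{d}: j=0,\dots,d-1\}$ be the subgroup of order $d$ of $\mathbb{Z}_n$, let $g\in\mathbb{Z}_n$, and let $j_0$ be an integer with $0\le j_0\le d-1$. Let $$B' = \left\{ j\cdot\tfrac{n}{d} : j=0,\dots,k_1-1\right\},\quad B'' = \left\{ cg + (j_0+j)\cdot\tfrac{n}{d} : j=0,\dots,k_2-1\right\},$$ and $B = B' \cup \bigcup_{i=1}^{c-1}(ig+H) \cup B''$, and assume $B$ has exactly $m$ elements (so $m\le n$). Assign to each element of $B$ an index: $0$ for elements of $B'$, $i$ for elements of $ig+H$ ($1\le i\le c-1$), and $c$ for elements of $B''$. Let $i_{\min}$ and $i_{\max}$ be the minimum and maximum of the sum of the indices of $h$ distinct elements of $B$, and for each integer $i$ let $h\hat{_i}B$ be the set of sums of $h$ distinct elements of $B$ whose indices sum to $i$. Assume that $g$ satisfies $i_{\max}\cdot g = i_{\min}\cdot g + \tfrac{n}{d}$ and that $B$ is special, i.e. one of $h\hat{_{i_{\max}}}B$, $h\hat{_{i_{\min}}}B$ is a subset of the other. Suppose moreover that $h \leq \max\{k_1,k_2\}$. Then $$|h\hat{\;}B| \geq u\hat{\;}(n,m,h) - 1;$$ furthermore, if equality holds, then one of the following holds: (i) $h=2$, $m-1$ is not a power of $2$, and $n$ is divisible by $2m-2$;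 (ii) $h=3$, $m=6$, and $n$ is divisible by $10$; (iii) $h$ is odd, $m+2$ is divisible by $h+2$, and $n$ is divisible by $hm-h^2$.
   Context: For a subset $A$ of $\mathbb{Z}_n$, $h\hat{\;}A$ denotes the set of sums of $h$ distinct elements of $A$. For positive integers $n,m,h$ with $m\le n$ and a positive divisor $e$ of $n$, write $m = c_e e + k_e$ with $c_e = \lceil m/e\rceil - 1$, $1\le k_e\le e$, let $H_e$ be the subgroup of order $e$ of $\mathbb{Z}_n$, and let $A_e(n,m) = \bigcup_{i=0}^{c_e-1}(i+H_e) \cup \{c_e + j\cdot\tfrac{n}{e} : j=0,\dots,k_e-1\}$. Then $u\hat{\;}(n,m,h) = \min\{ |h\hat{\;}A_e(n,m)| : e \text{ a positive divisor of } n\}$. *)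

(* Defs.v *)
From mathcomp Require Import all_boot all_algebra.

Set Implicit Arguments.
Unset Strict Implicit.
Unset Printing Implicit Defensive.

Import GRing.Theory.

(* The cyclic group of order n is 'Z_n, which has n elements only if n > 1
   ('Z_1 is Z/2Z). The theorem satisfies this constraint: k1, k2 < d and
   d < k1 + k2 give 3 <= d, and d divides n.  The element j * (n/d) of the
   group is (j * (n %/ d))%:R. *)

(* The minimum of a nonempty sequence (0 on the empty one): the default value
   of the iterated minimum is itself an element of the sequence. *)
Definition min_seq (s : seq nat) : nat := \big[minn/head 0 s]_(x <- s) x.

Definition hsubsets (T : finType) (h : nat) (A : {set T}) : {set {set T}} :=
  [set X : {set T} | (X \subset A) && (#|X| == h)].

Definition restricted_sumset n (h : nat) (A : {set 'Z_n}) : {set 'Z_n} :=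
  [set (\sum_(x in X) x)%R | X : {set 'Z_n} in hsubsets h A].

Definition subgroup_of_order n (d : nat) : {set 'Z_n} :=
  [set (j * (n %/ d))%:R%R | j : 'I_d].

Definition translate n (x : 'Z_n) (A : {set 'Z_n}) : {set 'Z_n} :=
  [set (x + y)%R | y in A].

Definition ceil_div (m e : nat) : nat := (m + e.-1) %/ e.

Definition c_ (m e : nat) : nat := ceil_div m e - 1.

Definition k_ (m e : nat) : nat := m - c_ m e * e.

Definition A_ n (m e : nat) : {set 'Z_n} :=
  (\bigcup_(i < c_ m e) translate i%:R%R (subgroup_of_order n e))
  :|: [set ((c_ m e)%:R + (j * (n %/ e))%:R)%R | j : 'I_(k_ m e)].

Definition uhat (n m h : nat) : nat :=
  min_seq [seq #|restricted_sumset h (A_ n m e)| | e <- divisors n].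

Lemma c_k_spec (m e : nat) (m_gt0 : 0 < m) (e_gt0 : 0 < e) :
  m = c_ m e * e + k_ m e /\ 1 <= k_ m e <= e.
Proof.
have cE : c_ m e = m.-1 %/ e.
  rewrite /c_ /ceil_div.
  have -> : m + e.-1 = m.-1 + e by rewrite -{1}(prednK m_gt0) addSnnS prednK.
  by rewrite divnDr ?dvdnn // divnn e_gt0 addnK.
have le1 : c_ m e * e <= m.-1 by rewrite cE leq_divM.
have le2 : m.-1 < (c_ m e).+1 * e by rewrite cE ltn_ceil.
rewrite /k_ subnKC; last exact: leq_trans le1 (leq_pred m).
split=> //; rewrite subn_gt0 leq_subLR -mulSnr; apply/andP; split.
  by apply: (leq_ltn_trans le1); rewrite ltn_predL.
exact: leq_trans (leqSpred m) le2.
Qed.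

Lemma min_seqP (s : seq nat) (x : nat) :
  x \in s -> min_seq s \in s /\ min_seq s <= x.
Proof.
rewrite /min_seq; case: s => [//|a s] xs; split=> /=; last first.
  have: forall r b, x \in r -> \big[minn/b]_(y <- r) y <= x.
    move=> r b; elim: r => // y r IHr; rewrite inE big_cons geq_min.
    by case/predU1P=> [->|/IHr->]; rewrite ?leqnn ?orbT.
  by apply.
rewrite big_seq; apply: (big_ind (fun y => y \in a :: s)) => //.
  exact: mem_head.
by move=> y z ys zs; case: (leqP y z).
Qed.

(* layer i is the set of elements of B of index i, for 0 <= i <= c. *)
Definition layer n (d k1 k2 c : nat) (g : 'Z_n) (j0 : nat) (i : nat) :
    {set 'Z_n} :=
  if i == 0 then [set (j * (n %/ d))%:R%R | j : 'I_k1]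
  else if i == c then
    [set (g *+ c + ((j0 + j) * (n %/ d))%:R)%R | j : 'I_k2]
  else translate (g *+ i)%R (subgroup_of_order n d).

Definition B_ n (d k1 k2 c : nat) (g : 'Z_n) (j0 : nat) : {set 'Z_n} :=
  \bigcup_(i < c.+1) layer d k1 k2 c g j0 i.

(* The first i in 0, ..., c such that x lies in layer i.  When
   #|B_| = k1 + (c - 1) * d + k2 the layers are pairwise disjoint, so this i
   is the only one. *)
Definition index_of n (d k1 k2 c : nat) (g : 'Z_n) (j0 : nat) (x : 'Z_n) :
    nat :=
  find (fun i => x \in layer d k1 k2 c g j0 i) (iota 0 c.+1).

Definition index_sum n (idx : 'Z_n -> nat) (X : {set 'Z_n}) : nat :=
  \sum_(x in X) idx x.

Definition index_min n (idx : 'Z_n -> nat) (h : nat) (B : {set 'Z_n}) : nat :=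
  min_seq [seq index_sum idx X | X in hsubsets h B].

Definition index_max n (idx : 'Z_n -> nat) (h : nat) (B : {set 'Z_n}) : nat :=
  \max_(X in hsubsets h B) index_sum idx X.

Definition restricted_sumset_at n (idx : 'Z_n -> nat) (h i : nat)
    (B : {set 'Z_n}) : {set 'Z_n} :=
  [set (\sum_(x in X) x)%R |
    X : {set 'Z_n} in hsubsets h B & index_sum idx X == i].

Definition special n (idx : 'Z_n -> nat) (h : nat) (B : {set 'Z_n}) : Prop :=
  let hB_max := restricted_sumset_at idx h (index_max idx h B) B in
  let hB_min := restricted_sumset_at idx h (index_min idx h B) B in
  hB_max \subset hB_min \/ hB_min \subset hB_max.

(* Main.v *)
(* Put w = n/d and L = i_max - i_min, so that L g = w.  Hence B lies in the
   cyclic group <g>, whose order e divides n, and m <= e.  Taking in Z_n an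
   arithmetic progression of length m, either with difference 1 or inside a
   subgroup of order e' >= m, gives
     uhat(n, m, h) <= h (m - h) + 1  and  uhat(n, m, h) <= e'.
   Distributing h elements over two consecutive layers as evenly as possible
   shows that every layer strictly between i_min and i_max contributes a full
   coset of <w>, while each of the two end layers contributes an arithmetic
   progression of known length.  If e <> d L, the middle layers already cover
   <g>; if e = d L, then |h^B| >= e minus the deficit of the longer of the two
   progressions.  What remains is arithmetic in two regimes, h <= min(k1, k2)
   and min(k1, k2) < h.  The second matters only for c = 1, the end layers being
   full otherwise, and gives (ii).  In the first one, equality forces either (i),
   or k1 = k2 with progressions missing one element each; these two missing
   elements are distinct when h is even, which leaves (iii). *)
Require Import Defs.
From mathcomp Require Import all_boot all_algebra all_fingroup cyclic zify.

Set Implicit Arguments.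
Unset Strict Implicit.
Unset Printing Implicit Defensive.

Import GRing.Theory.

(** * Sums of distinct integers *)

Lemma binS2 r : 'C(r.+1, 2) = 'C(r, 2) + r.
Proof. by rewrite binS bin1 addnC. Qed.

(** Here ['C(r, 2)] is the least sum of [r] distinct naturals and [v] the excess over it. By
    induction on [k], the top value is left out as long as the excess fits below it; otherwise
    taking it uses up its height above the least choice. *)
Lemma distinct_sum_exists k r v : r <= k -> v <= r * (k - r) ->
  exists J : seq nat, [/\ uniq J, size J = r, all (fun j => j < k) J &
    sumn J = 'C(r, 2) + v].
Proof.
elim: k r v => [|k IHk] r v.
  rewrite leqn0 => /eqP->; rewrite muln0 leqn0 => /eqP->.
  by exists [::].
case: r => [_|r].
  by rewrite mul0n leqn0 => /eqP->; exists [::].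
rewrite ltnS subSS => le_rk le_v.
have [le_v1|lt_v1] := boolP ((r < k) && (v <= r.+1 * (k - r.+1))).
  case/andP: le_v1 => lt_rk le_v1.
  have [J [uJ sJ aJ eJ]] := IHk _ _ lt_rk le_v1; exists J; split=> //.
  by apply: sub_all aJ => j /ltnW.
have le_krv : k - r <= v.
  move: lt_v1; rewrite negb_and -leqNgt -ltnNge => /orP[|]; first by lia.
  case: (ltnP r k) => [lt_rk|]; last by lia.
  nia.
have [|J [uJ sJ aJ eJ]] := IHk r (v - (k - r)) le_rk; first by nia.
exists (k :: J); split=> /=.
- by rewrite uJ andbT; apply/negP => /(allP aJ); rewrite ltnn.
- by rewrite sJ.
- by rewrite ltnSn; apply: sub_all aJ => j /ltnW.
- by rewrite eJ binS2; lia.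
Qed.

Lemma distinct_sum_bounds k J : uniq J -> all (fun j => j < k) J ->
  'C(size J, 2) <= sumn J <= 'C(size J, 2) + size J * (k - size J).
Proof.
elim: k J => [|k IHk] J uJ.
  by case: J uJ => [|j J].
have [kJ aJ|kJ aJ] := boolP (k \in J); last first.
  have aJ' : all (fun j => j < k) J.
    apply/allP => j jJ; have := allP aJ _ jJ; rewrite ltnS leq_eqVlt.
    by case/predU1P => // jk; rewrite -jk jJ in kJ.
  have /andP[-> le2] := IHk J uJ aJ'.
  by apply: leq_trans le2 _; rewrite leq_add2l leq_mul2l leq_sub2r ?orbT.
have pJ := perm_to_rem kJ.
have uJ' : uniq (rem k J) by rewrite rem_uniq.
have aJ' : all (fun j => j < k) (rem k J).
  apply/allP => j; rewrite (mem_rem_uniq _ uJ) !inE => /andP[jk jJ].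
  by have := allP aJ _ jJ; rewrite ltnS leq_eqVlt (negPf jk).
have sJ : size J = (size (rem k J)).+1 by rewrite (perm_size pJ).
rewrite sJ (perm_sumn pJ) /= binS2.
have le_sk : size (rem k J) <= k.
  rewrite -{2}(size_iota 0 k); apply: uniq_leq_size => // j /(allP aJ').
  by rewrite mem_iota.
have /andP[le1 le2] := IHk _ uJ' aJ'.
rewrite subSS mulSn.
move: le1 le2 le_sk; set a := sumn _; set r := size _; set b := binomial _ _.
by rewrite -!/r -!/b; move: (r * _) => e; clearbody a r b; lia.
Qed.

(** * Cyclic groups and the value of uhat *)

Section Cyclic.

Variables (n : nat) (n_gt1 : 1 < n).

Lemma natZn_eq0 x : ((x%:R : 'Z_n) == 0)%R = (n %| x).
Proof.
by rewrite -(inj_eq val_inj) /= val_Zp_nat.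
Qed.

Lemma mulrn_order_eq0 (g : 'Z_n) x : ((g *+ x)%R == 0%R) = (#[g]%g %| x).
Proof. by rewrite order_dvdn FinRing.zmodXgE. Qed.

Lemma order_dvd_n (g : 'Z_n) : #[g]%g %| n.
Proof. by have := order_dvdG (in_setT g); rewrite cardsT card_ord Zp_cast. Qed.

Lemma order_unit d : 0 < d -> d %| n -> #[((n %/ d)%:R : 'Z_n)%R]%g = d.
Proof.
move=> d_gt0 d_dvd.
have E x : (#[((n %/ d)%:R : 'Z_n)%R]%g %| x) = (d %| x).
  rewrite -mulrn_order_eq0 -mulrnA natZn_eq0 -{1}(divnK d_dvd).
  by rewrite dvdn_pmul2l // divn_gt0 // dvdn_leq // ltnW.
by apply/eqP; rewrite eqn_dvd E dvdnn -E dvdnn.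
Qed.

Lemma uhat_le m h e : 0 < e -> e %| n ->
  uhat n m h <= #|restricted_sumset h (A_ n m e)|.
Proof.
move=> e_gt0 e_dvd.
have e_in : e \in divisors n by rewrite -dvdn_divisors // ltnW.
by have [] := min_seqP
  (map_f (fun e => #|restricted_sumset h (A_ n m e)|) e_in).
Qed.

Lemma A_small m e : 0 < m -> m <= e ->
  A_ n m e = [set (j * (n %/ e))%:R%R | j : 'I_m].
Proof.
move=> m_gt0 le_me.
have e_gt0 := leq_trans m_gt0 le_me.
have [mE kE] := c_k_spec m_gt0 e_gt0.
have c0 : c_ m e = 0 by case: (c_ m e) mE => // c'; rewrite mulSn; lia.
have k0 : k_ m e = m by rewrite {2}mE c0.
rewrite /A_ c0 k0 big_ord0 set0U.
by apply: eq_imset => j; rewrite add0r.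
Qed.

Lemma progression_subset_sum (w : 'Z_n) m (X : {set 'Z_n}) :
  X \subset [set (w *+ j)%R | j : 'I_m] ->
  exists J, [/\ uniq J, size J = #|X|, all (fun j => j < m) J &
    (\sum_(x in X) x = w *+ sumn J)%R].
Proof.
move=> sXA.
(* The multiples of [w] may repeat, so one coefficient is chosen per element; distinct elements
   still get distinct coefficients. *)
pose f x := if [pick j : 'I_m | x == (w *+ j)%R] is Some j then val j else 0.
have fP x : x \in X -> f x < m /\ x = (w *+ f x)%R.
  move/(subsetP sXA)/imsetP => [j _ xE]; rewrite /f.
  case: pickP => [j' /eqP xE'|/(_ j)]; first by split=> //; exact: ltn_ord.
  by rewrite xE eqxx.
exists [seq f x | x <- enum X]; split.
- rewrite map_inj_in_uniq ?enum_uniq // => x y.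
  rewrite !mem_enum => /fP[_ xE] /fP[_ yE] fxy.
  by rewrite xE yE fxy.
- by rewrite size_map cardE.
- by apply/allP => j /mapP[x]; rewrite mem_enum => /fP[? _] ->.
rewrite sumnE big_map -sumrMnr.
rewrite [RHS]big_enum /=.
by apply: eq_bigr => x /fP[].
Qed.

(** All sums stay in the subgroup of order [e], which contains [A_ n m e]. *)
Lemma uhat_le_divisor m h e : 0 < m -> m <= e -> e %| n ->
  uhat n m h <= e.
Proof.
move=> m_gt0 le_me e_dvd; have e_gt0 := leq_trans m_gt0 le_me.
apply: leq_trans (uhat_le m h e_gt0 e_dvd) _; rewrite A_small //.
apply: leq_trans (_ : #|[set ((n %/ e)%:R *+ j : 'Z_n)%R | j : 'I_e]| <= e);
  last by apply: leq_trans (leq_imset_card _ _) _; rewrite card_ord.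
apply: subset_leq_card; apply/subsetP => _ /imsetP[X XA ->].
move: XA; rewrite inE => /andP[sXA _].
have [|J [_ _ _ ->]] := @progression_subset_sum (n %/ e)%:R%R m X.
  by under eq_imset => j do rewrite -mulrnA mulnC.
apply/imsetP; exists (Ordinal (ltn_pmod (sumn J) e_gt0)) => //=.
rewrite {1}(divn_eq (sumn J) e) mulrnDr mulnC mulrnA.
have -> : ((n %/ e)%:R *+ e = 0 :> 'Z_n)%R.
  by apply/eqP; rewrite -mulrnA divnK // natZn_eq0.
by rewrite mul0rn add0r.
Qed.

(** Taking the divisor [n] turns the set into the residues of [0, ..., m - 1], whose sums come from
    one short interval of integers. *)
Lemma uhat_le_linear m h : 0 < m <= n -> uhat n m h <= h * (m - h) + 1.
Proof.
case/andP=> m_gt0 le_mn.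
apply: leq_trans (uhat_le m h (ltnW n_gt1) (dvdnn n)) _; rewrite A_small //.
rewrite addn1; set N := (h * _).+1.
apply: (@leq_trans #|[set (('C(h, 2) + j)%:R : 'Z_n)%R | j : 'I_N]|); last first.
  by apply: leq_trans (leq_imset_card _ _) _; rewrite card_ord.
apply: subset_leq_card.
apply/subsetP => _ /imsetP[X XA ->].
move: XA; rewrite inE => /andP[sXA /eqP cX].
have [|J [uJ sJ aJ ->]] := @progression_subset_sum 1%R m X.
  by move: sXA; rewrite divnn ltnW //; under eq_imset => j do rewrite muln1.
have := distinct_sum_bounds uJ aJ; rewrite sJ cX => /andP[le1 le2].
have lt : sumn J - 'C(h, 2) < N by rewrite ltnS leq_subLR.
by apply/imsetP; exists (Ordinal lt); rewrite //= subnKC.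
Qed.

(** * Covering a cyclic group by cosets *)

Section Cover.

Variables (g w : 'Z_n) (S : {set 'Z_n}) (L i0 : nat).
Hypotheses (wE : w = (g *+ L)%R) (L_gt0 : 0 < L).
Hypothesis S_mid :
  forall i j, 0 < i < L -> (g *+ (i0 + i) + w *+ j)%R \in S.

Let cycle_cover (i1 : nat) (Y : {set 'Z_n}) :
  (forall x, (g *+ (i1 + x))%R \in Y) -> #[g]%g <= #|Y|.
Proof.
move=> gY; rewrite orderE -(card_imset _ (GRing.addrI (g *+ i1)%R)).
apply: subset_leq_card; apply/subsetP => _ /imsetP[_ /cycleP[x ->] ->].
by rewrite FinRing.zmodXgE -mulrnDr.
Qed.

(** Divide a coefficient of [g] by [L]: the quotient becomes a multiple of [w]. A nonzero remainder
    gives a middle coset, and remainder 0 the bottom coset, where [X] supplies what [S] lacks. *)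
Lemma order_le_cover (X : {set 'Z_n}) :
  (forall j, (g *+ i0 + w *+ j)%R \in S :|: X) -> #[g]%g <= #|S| + #|X|.
Proof.
move=> gSX.
apply: leq_trans (_ : #|S :|: X| <= _); last by rewrite cardsU leq_subr.
apply: (cycle_cover (i1 := i0)) => x.
rewrite (divn_eq x L) addnCA addnC mulrnDr mulnC mulrnA -wE.
have [->|r_gt0] := posnP (x %% L); first by rewrite addn0.
by rewrite inE S_mid // r_gt0 ltn_pmod.
Qed.

(** The cosets of [<w>] in [<g>] number [t = gcd(#[g], L)]. If [t < L], the middle indices already
    run through all residues modulo [t]. *)
Lemma order_le_proper_cover d : #[w]%g = d -> #[g]%g != d * L ->
  #[g]%g <= #|S|.
Proof.
move=> ow og.
have e_gt0 : 0 < #[g]%g by exact: order_gt0.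
set t := gcdn #[g]%g L.
have eE : #[g]%g = d * t.
  by rewrite -ow wE -FinRing.zmodXgE orderXgcd divnK // dvdn_gcdl.
have t_gt0 : 0 < t by rewrite gcdn_gt0 e_gt0.
have lt_tL : t < L.
  rewrite ltn_neqAle dvdn_leq ?dvdn_gcdr // andbT.
  by apply: contra og => /eqP tL; rewrite eE tL.
have [u gtE] : exists u, (g *+ t = w *+ u)%R.
  (* Bezout makes [t + a * L] a multiple of the order of [g], so [t g = - a w]; the factor [d.-1]
     stands for -1. *)
  have [a _ dv] := Bezoutl L e_gt0; exists (a * (d.-1)).
  have d_gt0 : 0 < d by case: (d) eE e_gt0 => // ->.
  have wd : (w *+ d = 0)%R by apply/eqP; rewrite mulrn_order_eq0 ow.
  apply/eqP; rewrite -(inj_eq (GRing.addIr (w *+ a)%R)) -mulrnDr.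
  rewrite addnC -mulnS prednK // mulnC mulrnA wd mul0rn.
  by rewrite wE -mulrnA -mulrnDr mulrn_order_eq0 [L * a]mulnC.
(* Starting one step above [i0] puts the remainders modulo [t] at the indices [1, ..., t], all below
   [L]. *)
apply: (cycle_cover (i1 := i0.+1)) => x.
rewrite (divn_eq x t) addnCA addnC mulrnDr mulnC mulrnA gtE -mulrnA addSnnS.
apply: S_mid; rewrite /=.
by apply: leq_ltn_trans lt_tL; rewrite ltn_pmod.
Qed.

End Cover.

End Cyclic.
(** * Arithmetic of the two regimes *)

(* In the next lemmas [e] is the order of [g], [N] the size of the restricted
   sumset of [B], [u] is [uhat n m h], and the smaller and larger of [k1], [k2]
   are [p] and [q]; each end layer misses at most [d.-1 - s] elements, with [s]
   the slack of an arithmetic progression. *)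
Lemma low_height_arith h c d p q N u e m :
  1 < h -> 0 < c -> h <= p -> p <= q -> q < d -> d < p + q ->
  m = p + q + (c - 1) * d -> e = d * (h * c) ->
  h * (q - h) < d.-1 ->
  e <= N + (d.-1 - h * (q - h)) -> u <= e -> u <= h * (m - h) + 1 ->
  (forall e', e = 2 * e' -> m <= e' -> u <= e') ->
  u <= N + 1 /\ (u = N + 1 ->
    [/\ h = 2, odd d & m = c * d + 1] \/
    [/\ p = q, d = h * (q - h) + 2 & h = 2 \/ d = h + 2]).
Proof.
move=> h_gt1 c_gt0 le_hp le_pq lt_qd lt_d mE eE s_lt e_le u_le u_le' u_half.
have [a qE] : exists a, q = h + a by exists (q - h); lia.
have [b dE] : exists b, d = p + b.+1 by exists (d - p).-1; lia.
have [c' cE] : exists c', c = c'.+1 by exists c.-1; lia.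
subst c; have qh : q - h = a by lia.
rewrite qh in s_lt e_le *.
have lin : h * (m - h) + h * b.+1 = e + h * a.
  have -> : m - h = a + p + c' * d by lia.
  by rewrite eE dE; nia.
(* If the gap [d.-1 - h * a] is 1, then [u <= e] suffices; for larger gaps the linear bound is used,
   compared with [e] through [lin]. *)
have [loss1|loss2] : d = h * a + 2 \/ h * a + 3 <= d by lia.
  split=> [|uE]; first by lia.
  right; have hb : h * b.+1 <= h * a + 1 by lia.
  have b_lt : b < a.
    rewrite ltnNge; apply/negP => le_ab.
    by have := leq_mul (leqnn h) le_ab; lia.
  (* From [b < a], [p <= q] and [d = h * a + 2] one gets [(h - 2)(a - 1) <= 0]. *)
  have [h2|h_gt2] : h = 2 \/ 2 < h by lia.
    by subst h; split; [lia | lia | left].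
  have a1 : a = 1.
    have [a' aE] : exists a', a = a'.+1 by exists a.-1; lia.
    have [h' h'E] : exists h', h = h'.+3 by exists (h - 3); lia.
    have : h * a = h' * a' + h' + 3 * a' + 3 by rewrite aE h'E; lia.
    have H : h * a + 2 = p + b.+1 by lia.
    by move: (h * a) (h' * a') H => ? ? ? ?; lia.
  by subst a; split; [lia | lia | right; lia].
have d_cases : d = h.+1 \/ exists t, d = h + 2 + t.
  have [] := leqP d h.+1; first by left; lia.
  by right; exists (d - h - 2); lia.
(* By [lin], this is exactly what makes the linear bound at most one more than the lower bound for
   [N]. *)
have key : d <= h * b.+1 + 1.
  have [dh|[t dt]] := d_cases.
    have a0 : a = 0 by lia.
    have b0 : b = 0 by lia.
    by rewrite b0; lia.
  have le1 : h * (t + 2) <= h * (b.+1 + a) by apply: leq_mul => //; lia.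
  have [h' h'E] : exists h', h = h'.+1 by exists h.-1; lia.
  have ht : h * (t + 2) = h' * t + t + 2 * h by rewrite h'E; lia.
  have h't : t <= h' * t by apply: leq_pmull; lia.
  move: le1; rewrite ht mulnDr.
  by move: (h' * t) (h * a) (h * b.+1) h't loss2 => ? ? ? ? ?; lia.
split=> [|uE]; first by lia.
left; have keyE : h * b.+1 + 1 = d by lia.
have [h2|h_gt2] : h = 2 \/ 2 < h by lia.
  subst h; have pq : p = q by lia.
  by split; lia.
exfalso.
have [dh|[t dt]] := d_cases.
  have a0 : a = 0 by lia.
  have b0 : b = 0 by lia.
  (* Now [p = q = h] and [d = h.+1], so [e] is even, and a subgroup of order [e / 2] gives too small
     a value of [u] for equality. *)
  have [r hr] : exists r, h * h.+1 = 2 * r.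
    by exists (h * h.+1)./2; rewrite mul2n even_halfK // oddM /= andbN.
  have r_ge : 2 * h <= r.
    have := leq_mul (leqnn h) h_gt2.
    by move: hr; rewrite mulnS; move: (h * h) => ?; lia.
  have eE' : e = 2 * (r * c'.+1) by rewrite eE dh mulnA [h.+1 * h]mulnC hr mulnA.
  have rc : r * c'.+1 = r + r * c' by rewrite mulnS.
  have le_rc : h.+1 * c' <= r * c' by rewrite leq_mul2r; apply/orP; right; lia.
  have := u_half (r * c'.+1) eE'; rewrite a0 muln0 in e_le.
  move: rc le_rc eE'; rewrite mulSn.
  by move: (r * c'.+1) (r * c') => ? ? ? ? ?; lia.
have le1 : h * (t + 2) <= h * (b.+1 + a) by apply: leq_mul => //; lia.
have [h' h'E] : exists h', h = h'.+3 by exists (h - 3); lia.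
have ht : h * (t + 2) = h' * t + 3 * t + 2 * h by rewrite h'E; lia.
have ha : a = 0 \/ h <= h * a by case: (a); [left | right; rewrite mulnS leq_addr].
have ha0 : a = 0 -> h * a = 0 by move=> ->; rewrite muln0.
move: le1; rewrite ht mulnDr => le1.
have [{}ha|{}ha] := ha.
  move: (ha0 ha) => {}ha0.
  by move: (h * a) (h * b.+1) (h' * t) ha0 keyE loss2 le1 => ? ? ? ? ? ? ?; lia.
by move: (h * a) (h * b.+1) (h' * t) ha keyE loss2 le1 => ? ? ? ? ? ? ?; lia.
Qed.

(** This is the case [c = 1] with the smaller end layer exhausted. One extreme sum takes all [h]
    elements from the larger layer, the other takes the whole smaller layer and [h - p] further
    elements; each gives a lower bound for [N]. *)
Lemma mid_height_arith h d p q N u e m :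
  1 < p -> p < h -> h <= q -> q < d -> d < p + q ->
  m = p + q -> e = d * p ->
  e <= N + (d.-1 - h * (q - h)) ->
  e <= N + (d.-1 - (h - p) * (q - (h - p))) ->
  u <= e -> u <= h * (m - h) + 1 ->
  u <= N + 1 /\ (u = N + 1 -> [/\ h = 3, m = 6 & e = 10]).
Proof.
move=> p_gt1 lt_ph le_hq lt_qd lt_d mE eE e_le1 e_le2 u_le u_le'.
have [x hE] : exists x, h = p + x.+1 by exists (h - p).-1; lia.
have [z qE] : exists z, q = h + z by exists (q - h); lia.
have [y dE] : exists y, d = q + y.+1 by exists (d - q).-1; lia.
have E1 : q - h = z by lia.
have E2 : h - p = x.+1 by lia.
have E3 : q - x.+1 = p + z by lia.
have E4 : m - h = p + z by lia.
rewrite E1 in e_le1; rewrite E2 E3 in e_le2; rewrite E4 in u_le'.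
have dq : d = p + x.+1 + z + y.+1 by lia.
(* Equality needs [d = q + 1]. For larger [d], [N] reaches either [e] or the linear bound, so that
   [u <= N]. *)
case: y {dE} dq => [|y] dq.
  have [le_e|lt_e] := leqP e N; first by split; lia.
  have x0 : x = 0.
    have le_x2 : x * 2 <= x * (p + z) by rewrite leq_mul2l; apply/orP; right; lia.
    rewrite mulSn in e_le2; clear e_le1 u_le' eE mE.
    by move: (x * (p + z)) le_x2 e_le2 => M le_x2 e_le2; lia.
  subst x; split=> [|uE]; first by lia.
  have hz : h * z = p * z + z by rewrite hE; lia.
  have z1 : z <= 1.
    rewrite leqNgt; apply/negP => z_gt1.
    have := leq_mul (leqnn p) z_gt1.
    by move: e_le1; rewrite hz; move: (p * z) => ?; lia.
  have eE' : e = p * p + p * (z + 2).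
    by rewrite eE dq -mulnDr mulnC; congr (_ * _); lia.
  have u_le2 : u <= p * p + p * z + p + z + 1 by move: u_le'; rewrite hE; lia.
  have p2 : p = 2 /\ z = 1.
    have pz : p * z = 0 /\ z = 0 \/ p * z = p /\ z = 1.
      have [z0|z_gt0] := posnP z; first by left; rewrite z0 muln0.
      have z1' : z = 1 by apply/eqP; rewrite eqn_leq z1.
      by right; rewrite z1' muln1.
    by move: u_le2 eE'; rewrite mulnDr; move: (p * p) (p * z) pz => ? ?; lia.
  by case: p2 => p2 z1'; subst p z; split; lia.
suff le_N : (p + x.+1) * (p + z) + 1 <= N \/ e <= N.
  by rewrite hE in u_le'; case: le_N; lia.
have big r : 2 * r + p + y + 2 <= p * (r + y + 2).
  have := leq_mul p_gt1 (leqnn r); have := leq_mul (ltnW p_gt1) (leqnn y).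
  by rewrite !mulnDr; move: (p * y) (p * r) => ? ?; lia.
(* The slacks [h * z] and [x.+1 * (p + z)] differ by [p * z - p * x.+1], so this comparison selects
   the end with the larger one. *)
have [le_xz|lt_zx] := leqP x.+1 z.
  have [M2|M2] := leqP d.-1 (h * z); first by right; lia.
  left; have dz : d <= p * (z + y + 2) by apply: leq_trans (big z); lia.
  have eE' : e = p * h + p * (z + y + 2).
    by rewrite eE mulnC -mulnDr; congr (_ * _); lia.
  rewrite -hE mulnDr [h * p]mulnC.
  by move: (p * h) (p * _) (h * z) dz eE' M2 e_le1 => ? ? ? ? ? ? ?; lia.
have [M1|M1] := leqP d.-1 (x.+1 * (p + z)); first by right; lia.
left; have dx : d <= p * (x.+1 + y + 2) by apply: leq_trans (big x.+1); lia.
have eE' : e = p * (p + z) + p * (x.+1 + y + 2).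
  by rewrite eE mulnC -mulnDr; congr (_ * _); lia.
rewrite mulnDl; move: (p * (p + z)) (p * _) (x.+1 * _) dx eE' M1 e_le2.
by move=> ? ? ? ? ? ? ?; lia.
Qed.

(** In the first case [m - 1 = c * d] with [d] odd and greater than 1, which excludes powers of 2.
    In the second, the parity hypothesis excludes [h = 2], so [d = h + 2] and [k1 = k2 = h + 1]. *)
Lemma equality_low h c d k1 k2 N u e m :
  1 < h -> 0 < c -> h <= minn k1 k2 -> k1 < d -> k2 < d -> d < k1 + k2 ->
  m = k1 + (c - 1) * d + k2 -> e = d * (h * c) -> N < e ->
  e <= N + (d.-1 - h * (maxn k1 k2 - h)) -> u <= e -> u <= h * (m - h) + 1 ->
  (forall e', e = 2 * e' -> m <= e' -> u <= e') ->
  (k1 = k2 -> d = h * (k1 - h) + 2 -> odd h) ->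
  u <= N + 1 /\ (u = N + 1 ->
    [/\ h = 2, ~ (exists a : nat, m - 1 = 2 ^ a) & 2 * m - 2 = e] \/
    [/\ odd h, h + 2 %| m + 2 & h * m - h ^ 2 = e]).
Proof.
move=> h_gt1 c_gt0 le_h k1_lt k2_lt d_lt mE eE lt_Ne e_gap u_e u_le half h_odd.
have gap : h * (maxn k1 k2 - h) < d.-1.
  rewrite ltnNge -subn_eq0; apply: contraL lt_Ne => /eqP d0.
  by rewrite -leqNgt -(addn0 N) -d0.
have le_pq : minn k1 k2 <= maxn k1 k2 by clear; lia.
have lt_qd : maxn k1 k2 < d by rewrite gtn_max k1_lt.
have lt_dpq : d < minn k1 k2 + maxn k1 k2 by rewrite addn_min_max.
have mE' : m = minn k1 k2 + maxn k1 k2 + (c - 1) * d.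
  by rewrite addn_min_max mE addnAC.
have [le_u eq_u] := low_height_arith h_gt1 c_gt0 le_h le_pq lt_qd lt_dpq mE' eE gap
  e_gap u_e u_le half.
split=> // /eq_u[[h2 odd_d {}mE']|[k12 dE h_or]]; [left | right].
  split=> //; last by rewrite eE h2 mE'; clear; lia.
  case=> a; rewrite mE' addnK => cd.
  have : d %| 2 ^ a by rewrite -cd dvdn_mull.
  have : coprime d (2 ^ a) by rewrite coprimeXr // coprimen2.
  rewrite /coprime => /eqP co /gcdn_idPl; rewrite co => d1.
  by clear -d1 k1_lt k2_lt d_lt; lia.
have {}k12 : k1 = k2 by clear -k12; lia.
rewrite -k12 maxnn in dE; have {}h_odd := h_odd k12 dE.
have d_h2 : d = h + 2 by case: h_or => // h2; rewrite h2 in h_odd.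
have k_h1 : k1 - h = 1.
  apply/eqP; rewrite -(eqn_pmul2l (ltnW h_gt1)) muln1.
  by rewrite -(eqn_add2r 2) -dE d_h2.
have m_ch : m + 2 = c.+1 * (h + 2).
  rewrite mE -k12 d_h2 -{2}(prednK c_gt0) !mulSn subn1.
  by move: (c.-1 * _) => X; clear -k_h1; lia.
split=> //; first by rewrite m_ch dvdn_mull.
have -> : h ^ 2 = h * h by [].
rewrite -mulnBr eE d_h2 mulnCA; congr (_ * _).
by rewrite mulnC; move: m_ch; rewrite mulSn; clear; lia.
Qed.

(** Exactly one of [k1], [k2] is below [h], and the truncated differences then evaluate to it;
    either way [mid_height_arith] applies. *)
Lemma equality_high h d k1 k2 N u e s0 s1 :
  minn k1 k2 < h -> h <= maxn k1 k2 -> k1 < d -> k2 < d -> d < k1 + k2 ->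
  h - (h - k2) - (h - k1) != 1 ->
  e = d * (h - (h - k2) - (h - k1)) ->
  e <= N + (d.-1 - s0) -> e <= N + (d.-1 - s1) ->
  s0 = (if k1 < h then (h - k1) * (k2 - (h - k1)) else h * (k1 - h)) ->
  s1 = (if k2 < h then (h - k2) * (k1 - (h - k2)) else h * (k2 - h)) ->
  0 < k1 -> 0 < k2 -> u <= e -> u <= h * (k1 + k2 - h) + 1 ->
  u <= N + 1 /\ (u = N + 1 -> [/\ h = 3, k1 + k2 = 6 & e = 10]).
Proof.
move=> lt_min le_max k1_lt k2_lt d_lt L1 eE e0 e1 s0E s1E k1_gt0 k2_gt0 u_e u_le.
have [lt1|le1] := ltnP k1 h.
  have le2 : h <= k2 by clear -lt1 le_max; lia.
  have Lk : h - (h - k2) - (h - k1) = k1 by clear -lt1 le2; lia.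
  rewrite lt1 in s0E; rewrite ltnNge le2 /= in s1E; rewrite Lk in eE L1.
  rewrite s0E in e0; rewrite s1E in e1.
  by apply: (mid_height_arith (p := k1) (q := k2)) e1 e0 _ _ => //; clear -L1 k1_gt0; lia.
have lt2 : k2 < h by clear -le1 lt_min; lia.
have Lk : h - (h - k2) - (h - k1) = k2 by clear -lt2 le1; lia.
rewrite lt2 in s1E; rewrite ltnNge le1 /= in s0E; rewrite Lk in eE L1.
rewrite s0E in e0; rewrite s1E in e1.
rewrite [k1 + k2]addnC in d_lt u_le *.
by apply: (mid_height_arith (p := k2) (q := k1)) e0 e1 _ _ => //; clear -L1 k2_gt0; lia.
Qed.

(** * The layers of B *)

Lemma uniq_map_inj (T1 T2 : eqType) (f : T1 -> T2) (s : seq T1) :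
  uniq (map f s) -> {in s &, injective f}.
Proof.
elim: s => //= a s IHs /andP[fa us] x y; rewrite !inE.
move=> /predU1P[->|xs] /predU1P[->|ys] // fxy.
- by rewrite fxy map_f in fa.
- by rewrite -fxy map_f in fa.
exact: IHs.
Qed.

Section Layers.

Variables (n d k1 k2 c j0 : nat) (g : 'Z_n).
Hypothesis c_gt0 : 0 < c.
Let w : 'Z_n := ((n %/ d)%:R)%R.
Let B := B_ d k1 k2 c g j0.
Let idx := index_of d k1 k2 c g j0.

Definition layer_size i := if i == 0 then k1 else if i == c then k2 else d.

Definition layer_shift i := if i == c then j0 else 0.

(** Coordinates (layer, position) give all layers one form and replace subsets of [B] by lists of
    pairs. *)
Definition position_elt (p : nat * nat) : 'Z_n :=
  (g *+ p.1 + w *+ (layer_shift p.1 + p.2))%R.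

Definition positions :=
  [seq (i, j) | i <- iota 0 c.+1, j <- iota 0 (layer_size i)].

Lemma mem_positions p :
  (p \in positions) = (p.1 <= c) && (p.2 < layer_size p.1).
Proof.
apply/allpairsPdep/andP => [[i [j [+ + ->]]]|[le_c lt_s]].
  by rewrite !mem_iota.
by exists p.1, p.2; rewrite !mem_iota; case: p le_c lt_s.
Qed.

Lemma size_positions : size positions = k1 + (c - 1) * d + k2.
Proof.
rewrite size_allpairs_dep sumnE big_map -[iota _ _]/(index_iota 0 c.+1).
rewrite -(prednK c_gt0) big_nat_recl // big_nat_recr //= !size_iota.
rewrite {1 3}/layer_size /= prednK // eqxx -addnA.
rewrite (eq_big_nat _ _ (F2 := fun=> d)).
  by rewrite sum_nat_const_nat subn0 subn1.
move=> i; rewrite size_iota /layer_size /= => lt_ic.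
by rewrite ltn_eqF // -ltn_predRL.
Qed.

Lemma layerE i :
  layer d k1 k2 c g j0 i =
  [set position_elt (i, val j) | j : 'I_(layer_size i)].
Proof.
rewrite /layer /layer_size /position_elt /layer_shift /=.
have wE j : ((j * (n %/ d))%:R = w *+ j :> 'Z_n)%R by rewrite mulnC mulrnA.
have [->|_] := eqVneq i 0.
  by rewrite (ltn_eqF c_gt0); apply: eq_imset => j; rewrite wE add0r.
have [->|_] := eqVneq i c; first by apply: eq_imset => j; rewrite wE.
rewrite /translate /subgroup_of_order -imset_comp.
by apply: eq_imset => j; rewrite /= wE.
Qed.

Lemma mem_layer i x :
  i <= c -> reflect (exists2 j, (i, j) \in positions & x = position_elt (i, j))
                    (x \in layer d k1 k2 c g j0 i).
Proof.
move=> le_ic; rewrite layerE; apply: (iffP imsetP) => [[j _ ->]|[j]].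
  by exists (val j); rewrite ?mem_positions /= ?le_ic ?ltn_ord.
by rewrite mem_positions => /andP[_ /= lt_j] ->; exists (Ordinal lt_j).
Qed.

Lemma B_positions : B = [set x in map position_elt positions].
Proof.
apply/setP => x; rewrite inE; apply/bigcupP/mapP => [[i _]|[[i j] p_in ->]].
  by case/(mem_layer _ (ltn_ord i)) => j ? ->; exists (val i, j).
have := p_in; rewrite mem_positions /= => /andP[le_ic _].
exists (Ordinal (le_ic : i < c.+1)) => //.
by apply/mem_layer => //; exists j.
Qed.

(** * Balanced distributions of the indices *)

Section Slack.

Variable h : nat.
Hypotheses (h_gt0 : 0 < h) (h_le : h <= maxn k1 k2).
Hypotheses (k1_gt0 : 0 < k1) (k2_gt0 : 0 < k2) (k1_lt : k1 < d) (k2_lt : k2 < d).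
Hypothesis d_lt : d < k1 + k2.

Let imin := h - k1.
Let imax := h * c - (h - k2).

Lemma imin_lt_imax : imin < imax.
Proof. by rewrite /imin /imax; nia. Qed.

(* The [h] indices are taken as equal as possible: [I = (I %/ h) * h + I %% h]
   is the sum of [h - I %% h] indices [I %/ h] and [I %% h] indices
   [(I %/ h).+1]. *)
Definition slack I :=
  (h - I %% h) * (layer_size (I %/ h) - (h - I %% h)) +
  I %% h * (layer_size (I %/ h).+1 - I %% h).

(** This is the coefficient of [w] when the balanced choice uses the lowest positions; the next
    [slack I] coefficients are reached too. *)
Definition offset I :=
  layer_shift (I %/ h) * (h - I %% h) + layer_shift (I %/ h).+1 * (I %% h) +
  'C(h - I %% h, 2) + 'C(I %% h, 2).

(** As [h < d], only the end layers could be too small, and [imin], [imax] are the thresholds for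
    them. At quotient [c] no next layer exists, and the remainder is 0. *)
Lemma balanced_fits I : imin <= I <= imax ->
  [/\ I %/ h <= c, h - I %% h <= layer_size (I %/ h) &
      I %% h <= (if I %/ h == c then 0 else layer_size (I %/ h).+1)].
Proof.
case/andP; rewrite /imin /imax => le_I I_le.
have h_lt : h < d by rewrite (leq_ltn_trans h_le) // gtn_max k1_lt.
have IE := divn_eq I h; have r_lt := ltn_pmod I h_gt0.
move: (I %/ h) (I %% h) IE r_lt => i r IE r_lt.
have le_ic : i <= c by rewrite leqNgt; apply/negP => lt_ci; nia.
rewrite /layer_size; split=> //.
  have [i0|_] := eqVneq i 0; first by move: IE; rewrite i0; lia.
  by have [ic|_] := eqVneq i c; nia.
have [ic|ic] := eqVneq i c; first by nia.
rewrite /=; have [icS|_] := eqVneq i.+1 c; nia.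
Qed.

Lemma mul_compl_ge a k : 0 < a < k -> k.-1 <= a * (k - a).
Proof. by nia. Qed.

(** A nonempty proper part of a layer of size [k] contributes at least [k.-1]. One layer of size [d]
    suffices; if both are end layers, [k1.-1 + k2.-1 >= d.-1]. *)
Lemma slack_middle I : imin < I < imax -> d.-1 <= slack I.
Proof.
rewrite /slack /imin /imax => /andP[lt_I I_lt].
have h_lt : h < d by rewrite (leq_ltn_trans h_le) // gtn_max k1_lt.
have IE := divn_eq I h; have r_lt := ltn_pmod I h_gt0.
move: (I %/ h) (I %% h) IE r_lt => i r IE r_lt.
have le_ic : i < c by rewrite ltnNge; apply/negP => lt_ci; nia.
have r1 : d.-1 <= (h - r) * (d - (h - r)) by apply: mul_compl_ge; lia.
rewrite {1}/layer_size (ltn_eqF le_ic).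
case: (posnP i) => [i0|i_gt0]; last by apply: leq_trans r1 (leq_addr _ _).
rewrite i0 /layer_size /=; case: eqP => c1; last first.
  apply: leq_trans (leq_addl _ _); apply: mul_compl_ge.
  by move: IE; rewrite i0; lia.
have r2 : k1.-1 <= (h - r) * (k1 - (h - r)).
  by apply: mul_compl_ge; move: IE; rewrite i0; nia.
have r3 : k2.-1 <= r * (k2 - r).
  by apply: mul_compl_ge; move: IE; rewrite i0; nia.
by apply: leq_trans (leq_add r2 r3); lia.
Qed.

(** When [k1 < h], layer 0 is exhausted and the slack comes from layer 1, which is a whole coset if
    [c > 1] and the other end layer if [c = 1]. *)
Lemma slack_imin :
  [/\ h <= k1 -> slack imin = h * (k1 - h),
      k1 < h -> 1 < c -> d.-1 <= slack imin &
      k1 < h -> c = 1 -> slack imin = (h - k1) * (k2 - (h - k1))].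
Proof.
have h_lt : h < d by rewrite (leq_ltn_trans h_le) // gtn_max k1_lt.
rewrite /slack /imin; split=> [le_hk|lt_kh c_gt1|lt_kh c1].
- by rewrite (eqP le_hk) div0n mod0n /= subn0 addn0.
- rewrite divn_small ?modn_small ?ltn_subrL ?k1_gt0 //.
  apply: leq_trans (leq_addl _ _); rewrite /layer_size /= (ltn_eqF c_gt1).
  by apply: mul_compl_ge; lia.
rewrite divn_small ?modn_small ?ltn_subrL ?k1_gt0 //.
by rewrite /layer_size c1 /= subKn ?subnn ?muln0 // ltnW.
Qed.

Lemma slack_imax :
  [/\ h <= k2 -> slack imax = h * (k2 - h),
      k2 < h -> 1 < c -> d.-1 <= slack imax &
      k2 < h -> c = 1 -> slack imax = (h - k2) * (k1 - (h - k2))].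
Proof.
have h_lt : h < d by rewrite (leq_ltn_trans h_le) // gtn_max k1_lt.
have E : k2 < h -> imax = c.-1 * h + k2.
  by rewrite /imax => lt_kh; rewrite -{1}(prednK c_gt0); nia.
have dE : k2 < h -> imax %/ h = c.-1.
  by move=> lt_kh; rewrite E // divnMDl // divn_small ?addn0.
have mE : k2 < h -> imax %% h = k2.
  by move=> lt_kh; rewrite E // modnMDl modn_small.
rewrite /slack; split=> [le_hk|lt_kh c_gt1|lt_kh c1].
- rewrite /imax (eqP le_hk) subn0 mulKn // modnMr subn0 addn0.
  by rewrite /layer_size (gtn_eqF c_gt0) eqxx.
- rewrite dE ?mE //; apply: leq_trans (leq_addr _ _).
  rewrite /layer_size; case: eqP => [|_]; first by lia.
  by case: eqP => [|_]; [lia | apply: mul_compl_ge; lia].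
by rewrite dE ?mE // /layer_size c1 /= subnn muln0 addn0.
Qed.

End Slack.

(** * Subsets of [B] and their index sums *)

Hypothesis card_B : #|B| = k1 + (c - 1) * d + k2.

(** There are as many positions as elements of [B], so none coincide. *)
Lemma position_elt_inj : {in positions &, injective position_elt}.
Proof.
apply: uniq_map_inj; apply/card_uniqP; rewrite size_map size_positions -card_B.
by rewrite B_positions cardsE.
Qed.

Lemma index_position p : p \in positions -> idx (position_elt p) = p.1.
Proof.
move=> p_in; have := p_in; rewrite mem_positions => /andP[le_pc _].
rewrite /idx /index_of; set P := fun i => _.
have Pp : P p.1 by apply/mem_layer => //; exists p.2 => //; case: (p) p_in.
have hasP : has P (iota 0 c.+1).
  by apply/hasP; exists p.1 => //; rewrite mem_iota.
have := nth_find 0 hasP; rewrite has_find size_iota in hasP.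
rewrite nth_iota // add0n /P => /mem_layer[//|j q_in /position_elt_inj eq].
by rewrite [in RHS](eq p_in q_in).
Qed.

Lemma positions_subset s : uniq s -> {subset s <= positions} ->
  exists2 X, X \in hsubsets (size s) B &
    index_sum idx X = \sum_(p <- s) p.1 /\
    (\sum_(x in X) x = \sum_(p <- s) position_elt p)%R.
Proof.
move=> us sP; pose X := [set x in map position_elt s].
have uX : uniq (map position_elt s).
  by rewrite map_inj_in_uniq // => p q /sP p_in /sP q_in; apply: position_elt_inj.
exists X; rewrite ?inE.
  apply/andP; split; last by rewrite cardsE (card_uniqP uX) size_map.
  rewrite B_positions; apply/subsetP => x; rewrite !inE.
  by case/mapP=> p /sP p_in ->; apply: map_f.
split.
  rewrite /index_sum; under eq_bigl => x do rewrite inE.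
  rewrite -big_uniq // big_map.
  by apply: eq_big_seq => p /sP/index_position.
by under eq_bigl => x do rewrite inE; rewrite -big_uniq // big_map.
Qed.

Lemma layer_sum i J :
  (\sum_(p <- map (pair i) J) position_elt p =
   g *+ (i * size J) + w *+ (layer_shift i * size J + sumn J))%R.
Proof.
elim: J => [|j J IHJ] /=; first by rewrite big_nil !muln0 !mulr0n addr0.
rewrite big_cons IHJ /position_elt /= addrACA -!mulrnDr !mulnS.
by congr (_ + _ *+ _)%R; rewrite addnACA.
Qed.

Lemma two_layer_sum i a b v :
  i <= c -> a <= layer_size i -> b <= (if i == c then 0 else layer_size i.+1) ->
  v <= a * (layer_size i - a) + b * (layer_size i.+1 - b) ->
  exists2 X, X \in hsubsets (a + b) B &
    index_sum idx X = i * a + i.+1 * b /\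
    (\sum_(x in X) x = g *+ (i * a + i.+1 * b) + w *+
      (layer_shift i * a + layer_shift i.+1 * b + 'C(a, 2) + 'C(b, 2) + v))%R.
Proof.
move=> le_ic le_a le_b le_v.
have lt_ic : 0 < b -> i < c.
  by case: (ltngtP i c) le_ic le_b => // _ _; rewrite leqn0 => /eqP->.
have le_b' : b <= layer_size i.+1 by move: le_b; case: eqP => // _; case: (b).
(* The excess [v] is spent in layer [i] first, and the rest in layer [i.+1]. *)
pose v1 := minn v (a * (layer_size i - a)).
have [J1 [uJ1 sJ1 aJ1 eJ1]] := distinct_sum_exists le_a (geq_minr v _ : v1 <= _).
have [|J2 [uJ2 sJ2 aJ2 eJ2]] := @distinct_sum_exists _ _ (v - v1) le_b'.
  by rewrite /v1; move: (a * _) (b * _) le_v => ? ?; lia.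
pose s := map (pair i) J1 ++ map (pair i.+1) J2.
have [||X XB [ixE sumE]] := @positions_subset s.
- have inj_pair k : injective (pair k : nat -> nat * nat) by move=> ? ? [].
  rewrite cat_uniq !map_inj_uniq // uJ1 uJ2 andbT /=.
  apply/hasPn => _ /mapP[j _ ->]; apply/mapP => -[j' _ [/eqP]].
  by rewrite -[_ == _]/(i.+1 == i) eqn_leq ltnn.
- move=> p; rewrite mem_cat mem_positions => /orP[] /mapP[j jJ ->] /=.
    by rewrite le_ic (allP aJ1).
  rewrite (allP aJ2) // andbT lt_ic // -sJ2; by case: (J2) jJ.
exists X; first by move: XB; rewrite size_cat !size_map sJ1 sJ2.
split.
  rewrite ixE big_cat !big_map /= !big_const_seq !count_predT sJ1 sJ2.
  by rewrite !iter_addn_0.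
rewrite sumE big_cat /= !layer_sum addrACA -!mulrnDr sJ1 sJ2 eJ1 eJ2.
congr (_ + _ *+ _)%R.
have : v1 <= v by rewrite geq_minl.
by move: (layer_shift _ * _) (layer_shift _ * _) => ? ?; lia.
Qed.

Lemma card_layer i : #|layer d k1 k2 c g j0 i| <= layer_size i.
Proof.
rewrite layerE; apply: leq_trans (leq_imset_card _ _) _.
by rewrite card_ord.
Qed.

Lemma mem_B_layer x : x \in B ->
  idx x <= c /\ x \in layer d k1 k2 c g j0 (idx x).
Proof.
rewrite B_positions inE => /mapP[[i j] p_in ->]; rewrite index_position //=.
have := p_in; rewrite mem_positions => /andP[le_ic _]; split=> //.
by apply/mem_layer => //; exists j.
Qed.

Lemma sum_mem_le (T : finType) (X A : {set T}) :
  \sum_(x in X) (x \in A : nat) <= #|A|.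
Proof.
rewrite -sum1_card big_mkcond [leqRHS]big_mkcond; apply: leq_sum => x _.
by case: (x \in X); case: (x \in A).
Qed.

(** At most [k1] elements have index 0 and at most [k2] have index [c]; every other one adds at
    least 1 and falls short of [c] by at least 1. *)
Lemma index_sum_bounds h X : X \in hsubsets h B ->
  h - k1 <= index_sum idx X <= h * c - (h - k2).
Proof.
rewrite inE => /andP[/subsetP sXB /eqP cX].
have le0 : h <= index_sum idx X + k1.
  rewrite -cX -sum1_card.
  apply: leq_trans (_ : _ <= index_sum idx X +
    \sum_(x in X) (x \in layer d k1 k2 c g j0 0 : nat)) _.
    rewrite -big_split; apply: leq_sum => x /sXB/mem_B_layer[_] /=.
    by case: (idx x) => [->|].
  by rewrite leq_add2l (leq_trans (sum_mem_le _ _)) // card_layer.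
have lec : index_sum idx X + h <= h * c + k2.
  rewrite -cX -sum1_card big_distrl /= -big_split /=.
  apply: leq_trans (_ : _ <= \sum_(x in X) 1 * c +
    \sum_(x in X) (x \in layer d k1 k2 c g j0 c : nat)) _.
    rewrite -big_split; apply: leq_sum => x /sXB/mem_B_layer[] /=.
    rewrite mul1n leq_eqVlt => /predU1P[->->//|lt_c _].
    by rewrite addn1 (leq_trans lt_c) ?leq_addr.
  rewrite leq_add2l (leq_trans (sum_mem_le _ _)) //.
  by apply: leq_trans (card_layer _) _; rewrite /layer_size (gtn_eqF c_gt0) eqxx.
(* This covers [h <= k2], where the subtraction [h - k2] truncates to 0. *)
have le_hc : index_sum idx X <= h * c.
  rewrite -cX -sum_nat_const; apply: leq_sum => x /sXB/mem_B_layer[] //.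
by apply/andP; split; lia.
Qed.

Variable h : nat.
Hypotheses (h_gt0 : 0 < h) (h_le : h <= maxn k1 k2).
Hypotheses (k1_gt0 : 0 < k1) (k2_gt0 : 0 < k2) (k1_lt : k1 < d) (k2_lt : k2 < d).
Hypothesis d_lt : d < k1 + k2.

Let imin := h - k1.
Let imax := h * c - (h - k2).

Let range_gt0 : imin < imax.
Proof. exact: imin_lt_imax h_gt0 h_le k1_gt0 k2_gt0 k1_lt k2_lt d_lt. Qed.

Lemma balanced_sum I v : imin <= I <= imax -> v <= slack h I ->
  exists2 X, X \in hsubsets h B &
    index_sum idx X = I /\
    (\sum_(x in X) x = g *+ I + w *+ (offset h I + v))%R.
Proof.
move=> I_in le_v; have [le_ic le_a le_b] :=
  balanced_fits h_gt0 h_le k1_gt0 k2_gt0 k1_lt k2_lt d_lt I_in.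
have [X] := two_layer_sum le_ic le_a le_b le_v.
rewrite subnK ?(ltnW (ltn_pmod _ _)) //.
have -> : I %/ h * (h - I %% h) + (I %/ h).+1 * (I %% h) = I.
  rewrite [RHS](divn_eq I h) mulSn addnCA -mulnDr addnC subnK //.
  by rewrite ltnW ?ltn_pmod.
by exists X.
Qed.

Lemma index_min_eq : index_min idx h B = imin.
Proof.
have lt_i := range_gt0.
have [|X XB [ixE _]] := @balanced_sum imin 0 _ isT; first by rewrite leqnn ltnW.
have := min_seqP (image_f (index_sum idx) XB).
rewrite -/(index_min idx h B) ixE => -[/imageP[Y YB ->] le_Y].
by apply/eqP; rewrite eqn_leq le_Y; have /andP[] := index_sum_bounds YB.
Qed.

Lemma index_max_eq : index_max idx h B = imax.
Proof.
have lt_i := range_gt0.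
have [|X XB [ixE _]] := @balanced_sum imax 0 _ isT; first by rewrite leqnn ltnW.
apply/eqP; rewrite eqn_leq; apply/andP; split.
  by apply/bigmax_leqP => Y /index_sum_bounds/andP[].
by rewrite -ixE; apply: leq_bigmax_cond.
Qed.

(** * Arcs in cosets of [<w>] and the order of [g] *)

Lemma mulrn_shift (x : 'Z_n) base j : (x *+ d = 0)%R -> 0 < d ->
  (x *+ j = x *+ (base + (j + base * d.-1) %% d))%R.
Proof.
move=> xd d_gt0.
have -> : (x *+ j = x *+ (j + base * d))%R.
  by rewrite mulrnDr [base * d]mulnC mulrnA xd mul0rn addr0.
have <- : (j + base * d.-1) + base = j + base * d.
  by rewrite -addnA -mulnSr prednK.
rewrite {1}(divn_eq (j + _) d) -addnA mulrnDr mulnC mulrnA xd mul0rn.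
by rewrite add0r addnC.
Qed.

(** The set [X] is the rest of the cycle after an arc of [V.+1] steps; it is empty once
    [V >= d.-1]. *)
Lemma arc_cover (t x : 'Z_n) (S : {set 'Z_n}) base V :
  (x *+ d = 0)%R -> 0 < d ->
  (forall v, v <= V -> (t + x *+ (base + v))%R \in S) ->
  exists2 X : {set 'Z_n}, #|X| <= d.-1 - V &
    forall j, (t + x *+ j)%R \in S :|: X.
Proof.
move=> xd d_gt0 arcS.
exists [set (t + x *+ (base + V.+1 + j))%R | j : 'I_(d.-1 - V)].
  by apply: leq_trans (leq_imset_card _ _) _; rewrite card_ord.
move=> j; rewrite (mulrn_shift base j xd d_gt0); set v := _ %% d.
rewrite inE; have [/arcS->//|lt_Vv] := leqP v V.
have lt_v : v - V.+1 < d.-1 - V.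
  by have : v < d := ltn_pmod _ d_gt0; lia.
apply/orP; right; apply/imsetP; exists (Ordinal lt_v) => //=.
by rewrite -addnA subnKC.
Qed.

Hypotheses (n_gt1 : 1 < n) (d_dvd_n : d %| n).
Hypothesis gE : (g *+ imax = g *+ imin + w)%R.
Let L := imax - imin.
Let S := restricted_sumset h B.

Let d_gt0 : 0 < d. Proof. by apply: leq_ltn_trans k1_lt. Qed.
Let order_w : #[w]%g = d. Proof. exact: order_unit. Qed.
Let w_d : (w *+ d = 0)%R.
Proof. by apply/eqP; rewrite mulrn_order_eq0 order_w. Qed.
Let L_gt0 : 0 < L. Proof. by rewrite subn_gt0 range_gt0. Qed.
Let wE : w = (g *+ L)%R.
Proof.
apply: (GRing.addrI (g *+ imin)%R); rewrite -gE -mulrnDr subnKC //.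
by rewrite ltnW ?range_gt0.
Qed.

Lemma arc_in_sumset I v : imin <= I <= imax -> v <= slack h I ->
  (g *+ I + w *+ (offset h I + v))%R \in S.
Proof.
by move=> I_in le_v; have [X XB [_ <-]] := balanced_sum I_in le_v; apply: imset_f.
Qed.

Lemma middle_layer_full i j : 0 < i < L -> (g *+ (imin + i) + w *+ j)%R \in S.
Proof.
case/andP=> i_gt0 i_lt; set I := imin + i.
have [I_gt I_lt] : imin < I /\ I < imax by rewrite /I; move: i_lt; rewrite /L; lia.
have sI : d.-1 <= slack h I by apply: slack_middle => //; rewrite I_gt.
have [|X cX] := @arc_cover (g *+ I)%R w S (offset h I) (slack h I) w_d d_gt0.
  by move=> v; apply: arc_in_sumset; rewrite (ltnW I_gt) (ltnW I_lt).
move: cX; rewrite (eqP sI) leqn0 cards_eq0 => /eqP-> /(_ j).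
by rewrite setU0.
Qed.

Lemma order_le_sumset : #[g]%g != d * L -> #[g]%g <= #|S|.
Proof. exact: (order_le_proper_cover wE L_gt0 middle_layer_full order_w). Qed.

Lemma order_le_imin : #[g]%g <= #|S| + (d.-1 - slack h imin).
Proof.
have [|X cX gX] :=
  @arc_cover (g *+ imin)%R w S (offset h imin) (slack h imin) w_d d_gt0.
  by move=> v; apply: arc_in_sumset; rewrite leqnn ltnW ?range_gt0.
apply: leq_trans (order_le_cover wE L_gt0 middle_layer_full gX) _.
by rewrite leq_add2l.
Qed.

(** By [gE] the top arc lies in the same coset as the bottom one, one step further on. *)
Let imax_arc v : v <= slack h imax ->
  (g *+ imin + w *+ ((offset h imax).+1 + v))%R \in S.
Proof.
move=> le_v; have := @arc_in_sumset imax v _ le_v.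
rewrite gE -addrA -mulrS; apply.
by rewrite leqnn ltnW ?range_gt0.
Qed.

Lemma order_le_imax : #[g]%g <= #|S| + (d.-1 - slack h imax).
Proof.
have [X cX gX] := arc_cover w_d d_gt0 imax_arc.
apply: leq_trans (order_le_cover wE L_gt0 middle_layer_full gX) _.
by rewrite leq_add2l.
Qed.

Lemma card_B_le_order : #|B| <= #[g]%g.
Proof.
rewrite orderE; apply: subset_leq_card; apply/subsetP => x.
rewrite B_positions inE => /mapP[p _ ->].
rewrite /position_elt wE -mulrnA -mulrnDr -FinRing.zmodXgE.
exact: mem_cycle.
Qed.

(* Otherwise the end layers lie in the same coset, which is too small. *)
Lemma index_range_neq : L != c.
Proof.
apply/eqP => Lc.
have : #|B| <= c * d.
  apply: (@leq_trans #|[set (g *+ val p.1 + w *+ val p.2)%R | p : 'I_c * 'I_d]|).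
    apply: subset_leq_card; apply/subsetP => x.
    rewrite B_positions inE => /mapP[[i j]].
    rewrite mem_positions /= => /andP[le_ic _] ->.
    have red k : (w *+ k = w *+ (k %% d))%R.
      by rewrite {1}(divn_eq k d) mulrnDr mulnC mulrnA w_d mul0rn add0r.
    rewrite /position_elt /=; apply/imsetP.
    have [lt_ic|] := ltnP i c.
      exists (Ordinal lt_ic, Ordinal (ltn_pmod (layer_shift i + j) d_gt0)) => //=.
      by rewrite -red.
    move=> le_ci; have -> : i = c by apply/eqP; rewrite eqn_leq le_ic.
    have gc : (g *+ c = w)%R by rewrite wE Lc.
    rewrite gc -mulrS.
    exists (Ordinal c_gt0, Ordinal (ltn_pmod (layer_shift c + j).+1 d_gt0)) => //=.
    by rewrite add0r -red.
  by apply: leq_trans (leq_imset_card _ _) _; rewrite card_prod !card_ord.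
rewrite card_B; apply/negP; rewrite -ltnNge.
by rewrite -{1}(prednK c_gt0) mulSn subn1; lia.
Qed.

(* Each of the two end layers misses one element of their common coset; by
   parity these two elements differ. *)
Lemma order_le_even : h <= k1 -> k1 = k2 -> d = h * (k1 - h) + 2 -> ~~ odd h ->
  #[g]%g <= #|S|.
Proof.
move=> le_h k12 dE even_h.
have le_h2 : h <= k2 by rewrite -k12.
have i0 : imin = 0 by apply/eqP.
have i1 : imax = h * c by rewrite /imax (eqP le_h2) subn0.
have d2 : h * (k1 - h) = d - 2 by rewrite {1}dE addnK.
have s0 : slack h imin = d - 2 by have [->] :=
  slack_imin h_gt0 h_le k1_gt0 k2_gt0 k1_lt k2_lt d_lt.
have s1 : slack h imax = d - 2 by have [->] :=
  slack_imax h_gt0 h_le k1_gt0 k2_gt0 k1_lt k2_lt d_lt; rewrite -?k12.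
have o0 : offset h imin = 'C(h, 2).
  by rewrite /offset i0 div0n mod0n /layer_shift (ltn_eqF c_gt0) subn0 muln0 !addn0.
have o1 : offset h imax = j0 * h + 'C(h, 2).
  rewrite /offset i1 mulKn // modnMr subn0 /layer_shift eqxx.
  by rewrite muln0 !addn0.
suff cov j : (g *+ imin + w *+ j)%R \in S :|: set0.
  have := order_le_cover wE L_gt0 middle_layer_full cov.
  by rewrite cards0 addn0.
rewrite setU0.
have odd_d : odd d = false by rewrite dE oddD oddM (negPf even_h).
have d1 : odd d.-1 by move: odd_d; rewrite -{1}(prednK d_gt0) /= => /negbFE.
rewrite (mulrn_shift (offset h imin) j w_d d_gt0); set v := _ %% d.
have lt_v : v < d by apply: ltn_pmod.
have [le_v|gt_v] := leqP v (slack h imin).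
  by apply: arc_in_sumset => //; rewrite leqnn ltnW ?range_gt0.
(* With slack [d - 2], the first arc misses only position [d.-1], which is odd. *)
have odd_v : odd v.
  by suff -> : v = d.-1 by []; move: gt_v; rewrite s0; clear -lt_v; lia.
rewrite -(mulrn_shift _ _ w_d d_gt0) (mulrn_shift (offset h imax).+1 j w_d d_gt0).
apply: imax_arc; set v' := _ %% d; have lt_v' : v' < d by apply: ltn_pmod.
(* The arcs start [j0 * h + 1] apart, an odd number, and [d] is even, so [v] and [v'] have opposite
   parities. *)
have : ~~ odd v'.
  move: odd_v; rewrite /v /v' o0 o1 !odd_mod // !oddD !oddM d1 !andbT /=.
  by rewrite oddD oddM (negPf even_h) andbF addbN => ->.
by rewrite s1; case: (eqVneq v' d.-1) => [->|]; [rewrite d1 | clear -lt_v'; lia].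
Qed.

End Layers.

Theorem theorem3p1 (n m h d c k1 k2 j0 : nat) (g : 'Z_n)
  (n_gt0 : 0 < n) (m_gt0 : 0 < m) (h_gt0 : 0 < h)
  (d_gt0 : 0 < d) (d_dvd_n : d %| n)
  (c_gt0 : 0 < c) (k1_gt0 : 0 < k1) (k2_gt0 : 0 < k2)
  (mE : m = k1 + (c - 1) * d + k2)
  (k1_lt_d : k1 < d) (k2_lt_d : k2 < d) (d_lt_k : d < k1 + k2)
  (j0_le : j0 <= d - 1) :
  let B := B_ d k1 k2 c g j0 in
  let idx := index_of d k1 k2 c g j0 in
  let i_min := index_min idx h B in
  let i_max := index_max idx h B in
  #|B| = m ->
  (g *+ i_max = g *+ i_min + (n %/ d)%:R)%R ->
  special idx h B ->
  h <= maxn k1 k2 ->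
  uhat n m h <= #|restricted_sumset h B| + 1 /\
  (uhat n m h = #|restricted_sumset h B| + 1 ->
   [\/ [/\ h = 2, ~ (exists a : nat, m - 1 = 2 ^ a) & 2 * m - 2 %| n],
       [/\ h = 3, m = 6 & 10 %| n]
     | [/\ odd h, h + 2 %| m + 2 & h * m - h ^ 2 %| n]]).
Proof.
move=> B idx i_min i_max cB.
have n_gt1 : 1 < n.
  by have := dvdn_leq n_gt0 d_dvd_n; lia.
have cB' : #|B| = k1 + (c - 1) * d + k2 by rewrite cB.
move=> gE _ h_le.
rewrite /i_min /i_max index_min_eq // index_max_eq // in gE.
set N := #|_|; set u := uhat n m h; set e := #[g]%g.
have le_me : m <= e by rewrite -cB; apply: card_B_le_order gE.
have e_dvd : e %| n by apply: order_dvd_n.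
have u_dvd e' : e' %| n -> m <= e' -> u <= e'.
  by move=> dv le; apply: uhat_le_divisor.
have le_mn : m <= n by apply: leq_trans le_me (dvdn_leq _ e_dvd).
have u_le : u <= h * (m - h) + 1 by apply: uhat_le_linear; rewrite // m_gt0.
have u_e : u <= e by apply: u_dvd.
have e_min : e <= N + (d.-1 - slack d k1 k2 c h (h - k1)).
  exact: order_le_imin gE.
have e_max : e <= N + (d.-1 - slack d k1 k2 c h (h * c - (h - k2))).
  exact: order_le_imax gE.
have [le_eN|lt_Ne] := leqP e N.
  have le_uN := leq_trans u_e le_eN.
  by split; [apply: leq_trans le_uN (leq_addr _ _) | clear -le_uN; lia].
have eE : e = d * (h * c - (h - k2) - (h - k1)).
  apply/eqP; apply: contraLR lt_Ne => e_neq; rewrite -leqNgt.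
  exact: order_le_sumset gE e_neq.
have L_neq : h * c - (h - k2) - (h - k1) != c.
  exact: (index_range_neq (j0 := j0)) gE.
have h_odd : h <= k1 -> k1 = k2 -> d = h * (k1 - h) + 2 -> odd h.
  move=> le_h k12 dE; apply: contraLR lt_Ne => even_h; rewrite -leqNgt.
  exact: order_le_even gE _ _ _ _.
have [min1 min2 min3] : [/\ _, _ & _] :=
  slack_imin c_gt0 h_gt0 h_le k1_gt0 k2_gt0 k1_lt_d k2_lt_d d_lt_k.
have [max1 max2 max3] : [/\ _, _ & _] :=
  slack_imax c_gt0 h_gt0 h_le k1_gt0 k2_gt0 k1_lt_d k2_lt_d d_lt_k.
have full s : d.-1 <= s -> e <= N + (d.-1 - s) -> False.
  by rewrite -subn_eq0 => /eqP->; rewrite addn0 leqNgt lt_Ne.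
have [le_h|lt_h] := leqP h (minn k1 k2).
  have [le_h1 le_h2] : h <= k1 /\ h <= k2 by apply/andP; rewrite -leq_min.
  rewrite (eqP le_h1) (eqP le_h2) !subn0 in eE L_neq.
  (* For [h = 1] the index range would be [c], contrary to [L_neq]. *)
  have h_gt1 : 1 < h.
    by move: h_gt0 L_neq; case: (h) => [|[|]] //; rewrite mul1n eqxx.
  have e_gap : e <= N + (d.-1 - h * (maxn k1 k2 - h)).
    by case: (leqP k1 k2) => _; rewrite -?min1 -?max1.
  have [||le_u eq_u] := equality_low h_gt1 c_gt0 le_h k1_lt_d k2_lt_d d_lt_k mE
    eE lt_Ne e_gap u_e u_le.
  - move=> e' ee' le_me'; apply: u_dvd => //; apply: dvdn_trans e_dvd.
    by rewrite ee' dvdn_mull.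
  - exact: h_odd.
  split=> // /eq_u[[h2 npow mE']|[odd_h dv_h mE']].
    by apply: Or31; rewrite mE'.
  by apply: Or33; rewrite mE'.
(* For [c > 1], an end layer with fewer than [h] elements is completed from a whole coset, so that
   end misses nothing, contrary to [N < e]. *)
have c1 : c = 1.
  apply/eqP; rewrite eqn_leq c_gt0 andbT leqNgt; apply/negP => c_gt1.
  have [lt1|le1] := ltnP k1 h; first exact: full (min2 lt1 c_gt1) e_min.
  have lt2 : k2 < h by move: lt_h; rewrite gtn_min => /orP[|//]; rewrite ltnNge le1.
  exact: full (max2 lt2 c_gt1) e_max.
subst c; rewrite mul0n addn0 in mE; rewrite muln1 in eE L_neq min3 max3 max1 e_max.
rewrite mE in u_le *.
have [||le_u eq_u] := equality_high lt_h h_le k1_lt_d k2_lt_d d_lt_k L_neq eE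
  e_min e_max _ _ k1_gt0 k2_gt0 u_e u_le.
- by case: ltnP => [/min3->|/min1->].
- by case: ltnP => [/max3->|/max1->].
by split=> // /eq_u[h3 m6 e10]; apply: Or32; rewrite -e10.
Qed.
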